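(* A graph $G$ is proportionally $(2,2)$-choosable if and only if $G$ is a bipartite graph with a bipartition $X, Y$ satisfying $\bigl||X|-|Y|\bigr| \leq 1$.
   Context: All graphs are nonempty, finite and simple. A bipartition of a bipartite graph is a partition of its vertex set into two (possibly empty) independent sets $X,Y$. For $m\in\mathbb{N}=\{1,2,3,\ldots\}$, $[m]=\{1,\ldots,m\}$. For integers $1\le k\le \ell$, a $(k,\ell)$-assignment for a graph $G$ is a function $L$ assigning to each vertex $v$ of $G$ a set $L(v)\subseteq[\ell]$ with $|L(v)|=k$. Let $\mathcal{L}=\bigcup_{v\in V(G)}L(v)$ and, for $c\in\mathcal{L}$, let $\eta(c)=|\{v\in V(G): c\in L(v)\}|$. A proportional $L$-coloring of $G$ is a function $f$ on $V(G)$ with $f(v)\in L(v)$ for every $v$, with $f(u)\ne f(v)$ whenever $u,v$ are adjacent, and with $|f^{-1}(c)|\in\{\lfloor \eta(c)/k\rfloor,\lceil \eta(c)/k\rceil\}$ for every $c\in\mathcal{L}$. $G$ is proportionally $(k,\ell)$-choosable if a proportional $L$-coloring of $G$ exists for every $(k,\ell)$-assignment $L$ for $G$. *)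

(* Defs.v *)
From mathcomp Require Import all_boot all_order all_algebra.

Set Implicit Arguments.
Unset Strict Implicit.
Unset Printing Implicit Defensive.

(* A graph is a relation e on a finType T; simplicity and nonemptiness of the
   graph are the three conditions of simple_graph.  The palette {1, ..., l} is
   encoded as 'I_l = {0, ..., l - 1}. *)
Definition simple_graph (T : finType) (e : rel T) : Prop :=
  [/\ symmetric e, irreflexive e & 0 < #|T|].

Definition independent (T : finType) (e : rel T) (A : {set T}) : Prop :=
  forall u v : T, u \in A -> v \in A -> ~~ e u v.

(* Unlike finset's [partition], X and Y may be empty. *)
Definition bipartition (T : finType) (e : rel T) (X Y : {set T}) : Prop :=
  [/\ X :|: Y = [set: T], [disjoint X & Y], independent e X & independent e Y].

Definition assignment (T : finType) (k l : nat) (L : T -> {set 'I_l}) : Prop :=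
  forall v : T, #|L v| = k.

Definition palette (T : finType) (l : nat) (L : T -> {set 'I_l}) : {set 'I_l} :=
  \bigcup_(v : T) L v.

Definition eta (T : finType) (l : nat) (L : T -> {set 'I_l}) (c : 'I_l) : nat :=
  #|[set v : T | c \in L v]|.

(* The ceiling of m / k, for k > 0. *)
Definition ceil_div (m k : nat) : nat := (m + k.-1) %/ k.

Definition proportional_coloring (T : finType) (e : rel T) (k l : nat)
    (L : T -> {set 'I_l}) (f : T -> 'I_l) : Prop :=
  [/\ forall v : T, f v \in L v,
      forall u v : T, e u v -> f u != f v
    & forall c : 'I_l, c \in palette L ->
        #|f @^-1: [set c]| = eta L c %/ k \/
        #|f @^-1: [set c]| = ceil_div (eta L c) k].

(* Meaningful for 1 <= k <= l. *)
Definition proportionally_choosable (T : finType) (e : rel T) (k l : nat)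
    : Prop :=
  forall L : T -> {set 'I_l}, assignment k L ->
    exists f : T -> 'I_l, proportional_coloring e k L f.

(* Main.v *)
Require Import Defs.
From mathcomp Require Import all_boot all_order all_algebra.
From mathcomp Require Import zify.
Import Order.TTheory GRing.Theory Num.Theory.

(** With two colors and lists of size 2, every list is the whole palette ([assignment_full]), so
    there is only one assignment, and each color has multiplicity [#|T|] ([eta_full]). A
    proportional coloring is thus a proper 2-coloring whose classes each have size [#|T|] / 2
    rounded down or up. Its two classes form a balanced bipartition; conversely, coloring the two
    sides of a balanced bipartition differently gives such a coloring. *)

Lemma assignment_full (T : finType) (k : nat) (L : T -> {set 'I_k}) :
  assignment k L -> forall v, L v = [set: 'I_k].
Proof.
move=> kL v; apply/eqP; rewrite eqEcard subsetT cardsT card_ord kL.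
exact: leqnn.
Qed.

Lemma eta_full (T : finType) (l : nat) (L : T -> {set 'I_l}) (c : 'I_l) :
  (forall v, L v = [set: 'I_l]) -> eta L c = #|T|.
Proof.
by move=> fullL; rewrite /eta -cardsT; apply: eq_card => v;
  rewrite !inE fullL inE.
Qed.

Lemma ord2_cases (c : 'I_2) : c = ord0 \/ c = ord_max.
Proof. by case: c => [[|[|m]] //= lt]; [left|right]; apply: val_inj. Qed.

Theorem mainTheorem7 (T : finType) (e : rel T) (eG : simple_graph e) :
  proportionally_choosable e 2 2 <->
  (exists X Y : {set T},
     bipartition e X Y /\ (`| #|X|%:Z - #|Y|%:Z | <= 1 :> int)%R).
Proof.
case: eG => _ _ T_gt0; split=> [chooseG | [X [Y [[XUY dXY iX iY] balXY]]] L kL].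
  have [|f [_ f_proper f_prop]] := chooseG (fun _ => [set: 'I_2]).
    by move=> v; rewrite cardsT card_ord.
  have f_class c : independent e (f @^-1: [set c]).
    move=> u v; rewrite !inE => /eqP fu /eqP fv.
    by apply/negP => /f_proper; rewrite fu fv eqxx.
  have f_card c : #|f @^-1: [set c]| = #|T| %/ 2 \/
                  #|f @^-1: [set c]| = ceil_div #|T| 2.
    rewrite -(eta_full T 2 (fun=> [set: 'I_2]) c) //; apply: f_prop.
    (* Nonemptiness of the graph puts every color in the palette, so the size condition holds even
       for a color that [f] never uses. *)
    by have [v _] := card_gt0P T_gt0; apply/bigcupP; exists v; rewrite ?inE.
  exists (f @^-1: [set ord0]), (f @^-1: [set ord_max]); split.
    split=> //.
      by apply/setP => v; rewrite !inE; case: (ord2_cases (f v)) => ->.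
    by apply/pred0P => v; rewrite /= !inE; case: (ord2_cases (f v)) => ->.
  (* Both class sizes are the floor or the ceiling of the same half, and these differ by at most
     1. *)
  by move: (f_card ord0) (f_card ord_max); rewrite /ceil_div; lia.
have fullL := assignment_full _ _ _ kL.
have inXY v : (v \in X) || (v \in Y) by rewrite -in_setU XUY inE.
have YE : Y = ~: X.
  apply/setP => v; rewrite inE; have := inXY v.
  by case: (boolP (v \in X)) => [/(disjointFr dXY)|].
have cardXY : #|X| + #|Y| = #|T| by rewrite YE cardsC.
pose f v : 'I_2 := if v \in X then ord0 else ord_max.
exists f; split=> [v | u v euv | c _]; first by rewrite fullL inE.
  rewrite /f; have := inXY u; have := inXY v.
  case: ifP => uX; case: ifP => vX //= vY uY.
    by have := iX u v uX vX; rewrite euv.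
  by have := iY u v uY vY; rewrite euv.
(* By [cardXY] and [balXY], two sizes with sum [#|T|] and difference at most 1 are each half of
   [#|T|], rounded down or up. *)
rewrite eta_full // /ceil_div.
case: (ord2_cases c) => ->.
  have -> : f @^-1: [set ord0] = X.
    by apply/setP => v; rewrite !inE /f; case: ifP.
  lia.
have -> : f @^-1: [set ord_max] = Y.
  by apply/setP => v; rewrite YE !inE /f; case: ifP.
lia.
Qed.
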